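(* Let $H$ be an $n$-vertex $3$-graph with $n\ge 8$ and $\delta_2(H)\ge 3$. Then for every vertex $u$ of $H$ there are six distinct vertices $v_1,\dots,v_6$, all different from $u$, such that $\{u,v_1,v_2\},\{u,v_3,v_4\},\{v_4,v_5,v_6\}$ are edges of $H$ (a linear $3$-path in which $u$ is the intersection of the first two edges).
   Context: $\delta_2(H)$ is the minimum over pairs of vertices of the number of edges containing the pair. *)

(* Defs.v *)
From mathcomp Require Import all_boot.

Set Implicit Arguments.
Unset Strict Implicit.
Unset Printing Implicit Defensive.

Record three_graph (V : finType) := ThreeGraph {
  edges :> {set {set V}};
  edges_card3 : forall e, e \in edges -> #|e| = 3
}.

Definition codeg (V : finType) (H : three_graph V) (P : {set V}) : nat :=
  #|[set e in edges H | P \subset e]|.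

(* minn has no neutral element; #|edges H| bounds every codegree, so for
   #|V| >= 2 the initial value does not affect the minimum. *)
Definition delta2 (V : finType) (H : three_graph V) : nat :=
  \big[minn/#|edges H|]_(P : {set V} | #|P| == 2) codeg H P.

(* Main.v *)
(** In the link of [u], disjoint edges [ab] and [cd] confine the edges of [H]:
    without a path as required, the third vertex of every edge through [d] and
    an outside vertex [x] lies in [{u, a, b, c}], and likewise for [a], [b]
    and [c].  As every pair lies in three edges, such a pair misses at most
    one of these four candidates.  If the link has an edge [dx] leaving
    [{a, b, c, d}], comparing the matchings [ab, cd] and [ab, dx] makes the
    neighbourhoods of [{d, y}] exactly [{u, a, b}] for every outside [y];
    this yields the link edge [cx], and the matching [cx, dy] contradicts
    the edge [adz].  Otherwise the edges [acz] are forced, and a link edge [xy]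
    outside [{a, b, c, d}] together with [ab] contradicts one of them. *)

Require Import Defs.
From mathcomp Require Import all_boot.

Set Implicit Arguments.
Unset Strict Implicit.

Lemma bigmin_leq (I : eqType) (r : seq I) (P : pred I) (F : I -> nat) m i :
  i \in r -> P i -> \big[minn/m]_(j <- r | P j) F j <= F i.
Proof.
elim: r => // j r IHr; rewrite inE big_cons => /orP[/eqP <- -> | ir Pi].
  exact: geq_minl.
case: ifP => _; last exact: IHr.
exact: leq_trans (geq_minr _ _) (IHr ir Pi).
Qed.

Lemma delta2_leq_codeg (V : finType) (H : three_graph V) (x y : V) :
  x != y -> delta2 H <= codeg H [set x; y].
Proof.
by move=> xy; apply: bigmin_leq; rewrite ?mem_index_enum // cards2 xy.
Qed.

Lemma exists_notin (V : finType) (s : seq V) :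
  size s < #|V| -> exists x, x \notin s.
Proof.
move=> ltsV; apply/existsP; apply: contraLR ltsV => /existsPn sV.
rewrite -leqNgt; apply: leq_trans (card_size s).
by apply/subset_leq_card/subsetP => x _; move: (sV x); rewrite negbK.
Qed.

Ltac split_distinct :=
  repeat match goal with
  | h : is_true (uniq _) |- _ => rewrite /= !inE !negb_or /= in h
  | h : is_true (_ \notin _ :: _) |- _ => rewrite !inE ?negb_or in h
  | h : is_true (_ && _) |- _ => case/andP: h => ? ?
  end.

Ltac distinct :=
  split_distinct; rewrite /= ?inE ?negb_or;
  repeat (apply/andP; split); by [| rewrite eq_sym].

Section LinearPath.

Variables (V : finType) (H : three_graph V).
Hypotheses (cardV_ge8 : 8 <= #|V|) (delta2_ge3 : 3 <= delta2 H).

Local Notation E x y z := ([set x; y; z] \in edges H).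

Lemma edge_swap x y z : E x y z -> E y x z.
Proof. by rewrite (setUC [set x]). Qed.

Lemma edge_rot x y z : E x y z -> E y z x.
Proof. by rewrite -setUA setUC. Qed.

Lemma edge_swapr x y z : E x y z -> E x z y.
Proof. by rewrite setUAC. Qed.

Lemma edge_uniq x y z : E x y z -> uniq [:: x; y; z].
Proof.
move/edges_card3; rewrite setUC cardsU1 cards2 !inE /=.
by rewrite !inE negb_or (eq_sym x z) (eq_sym y z); do 3 case: eqP.
Qed.

(** At most two edges through [x] and [y] have third vertex [p] or [q], while the codegree is at
    least 3. *)
Lemma exists_third x y p q : x != y -> exists z, [/\ E x y z, z != p & z != q].
Proof.
move=> xy; have /(leq_trans delta2_ge3) := delta2_leq_codeg H xy.
have [/existsP[z /and3P[]] | /existsPn noz] :=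
  boolP [exists z, [&& E x y z, z != p & z != q]]; first by exists z.
suff /subset_leq_card sub : [set e in edges H | [set x; y] \subset e]
                     \subset [set [set x; y; p]; [set x; y; q]].
  by move/leq_trans/(_ sub); rewrite cards2; case: (_ != _).
apply/subsetP => e; rewrite inE => /andP[eH xye].
have /eqP/cards1P[z ez] : #|e :\: [set x; y]| = 1.
  by rewrite cardsD (setIidPr xye) (edges_card3 eH) cards2 xy.
have eE : e = [set x; y; z].
  by rewrite -[LHS](setID e [set x; y]) (setIidPr xye) ez.
move: (noz z); rewrite -eE eH /= negb_and !negbK.
by rewrite !inE eE => /orP[] /eqP ->; rewrite eqxx ?orbT.
Qed.

Variable u : V.
Hypothesis no_path : forall v1 v2 v3 v4 v5 v6 : V,
  uniq [:: u; v1; v2; v3; v4; v5; v6] ->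
  E u v1 v2 -> E u v3 v4 -> E v4 v5 v6 -> False.

(** Otherwise [uab], [ucd], [dxz] form the forbidden path; [z] differs from [d] and [x] because
    edges have three vertices. *)
Lemma edge_confined a b c d x z :
  uniq [:: u; a; b; c; d; x] -> E u a b -> E u c d -> E d x z ->
  z \in [:: u; a; b; c].
Proof.
move=> Us uab ucd dxz; apply: contraT => zs.
have Ud := edge_uniq dxz.
by case: (@no_path a b c d x z) => //; distinct.
Qed.

(** Confinement applies to both link matchings [ab, cd] and [ab, xd]; the two candidate lists differ
    only in [c] and [x], which are distinct. *)
Lemma edge_confined2 a b c d x y z :
  uniq [:: u; a; b; c; d; x; y] -> E u a b -> E u c d -> E u x d ->
  E d y z -> z \in [:: u; a; b].
Proof.
move=> Us uab ucd uxd dyz.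
have : z \in [:: u; a; b; c] by apply: edge_confined _ uab ucd dyz; distinct.
have : z \in [:: u; a; b; x] by apply: edge_confined _ uab uxd dyz; distinct.
rewrite !inE; do 3 (case: eqP => //= _).
by move=> /eqP-> /eqP xc; move: Us; rewrite xc /= !inE eqxx ?orbT ?andbF.
Qed.

Lemma no_link_edge_out a b c d x :
  uniq [:: u; a; b; c; d; x] -> E u a b -> E u c d -> E u d x -> False.
Proof.
move=> Us uab ucd /edge_swapr uxd.
have [y] := @exists_notin V [:: u; a; b; c; d; x] (ltnW cardV_ge8).
have [z] := @exists_notin V [:: u; a; b; c; d; x; y] cardV_ge8.
move=> zs ys.
(* Only [u], [a], [b] can complete [d] and [y]; avoiding two of them forces the third. *)
have [v [dyv va vb]] : exists v, [/\ E d y v, v != a & v != b].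
  by apply: exists_third; distinct.
have vu : v = u.
  have : v \in [:: u; a; b].
    by apply: edge_confined2 _ uab ucd uxd dyv; distinct.
  by rewrite !inE (negPf va) (negPf vb) !orbF => /eqP.
have uyd : E u y d by apply/edge_swap/edge_rot; rewrite -vu.
have [t [dzt tu tb]] : exists t, [/\ E d z t, t != u & t != b].
  by apply: exists_third; distinct.
have ta : t = a.
  have : t \in [:: u; a; b].
    by apply: edge_confined2 _ uab ucd uxd dzt; distinct.
  by rewrite !inE (negPf tu) (negPf tb) orbF => /eqP.
have [w [cxw wa wb]] : exists w, [/\ E c x w, w != a & w != b].
  by apply: exists_third; distinct.
(* The link edge [yd] now plays the role of [xd], so [c] cannot complete [d] and [x]. *)
have wd : w != d.
  apply/eqP => wd; have dxc : E d x c.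
    by rewrite wd in cxw; apply/edge_rot/edge_swap/edge_rot/edge_rot.
  have : c \in [:: u; a; b].
    by apply: edge_confined2 _ uab ucd uyd dxc; distinct.
  by apply/negP; distinct.
have wu : w = u.
  have udc : E u d c by apply: edge_swapr.
  have : w \in [:: u; a; b; d].
    by apply: edge_confined _ uab udc cxw; distinct.
  by rewrite !inE (negPf wa) (negPf wb) (negPf wd) !orbF => /eqP.
have ucx : E u c x by rewrite -wu; do 2 apply: edge_rot.
(* The matching [cx, yd] avoids [a], yet [t = a] completes [d] and [z]. *)
have : t \in [:: u; c; x; y].
  by apply: edge_confined _ ucx uyd dzt; distinct.
by apply/negP; rewrite ta; distinct.
Qed.

Lemma no_path_false : False.
Proof.
have [a au] : exists a, a \notin [:: u].
  by apply: exists_notin; apply: leq_trans cardV_ge8.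
(* The exclusions are vacuous here: any edge through [u] and [a] will do. *)
have [b [uab _ _]] : exists b, [/\ E u a b, b != u & b != u].
  by apply: exists_third; distinct.
have Uab := edge_uniq uab.
have [c cs] : exists c, c \notin [:: u; a; b].
  by apply: exists_notin; apply: leq_trans cardV_ge8.
have [d [ucd da db]] : exists d, [/\ E u c d, d != a & d != b].
  by apply: exists_third; distinct.
have Ucd := edge_uniq ucd.
have [x xs] : exists x, x \notin [:: u; a; b; c; d].
  by apply: exists_notin; apply: leq_trans cardV_ge8.
have uba : E u b a by apply: edge_swapr.
have udc : E u d c by apply: edge_swapr.
(* By symmetry of the matching [ab, cd], no link edge leaves its four vertices; hence a link edge at
   the outside vertex [x] lies wholly outside. *)
have noa t : t \notin [:: u; a; b; c; d] -> ~ E u a t.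
  by move=> ts; apply: no_link_edge_out _ ucd uba; distinct.
have nob t : t \notin [:: u; a; b; c; d] -> ~ E u b t.
  by move=> ts; apply: no_link_edge_out _ ucd uab; distinct.
have noc t : t \notin [:: u; a; b; c; d] -> ~ E u c t.
  by move=> ts; apply: no_link_edge_out _ uab udc; distinct.
have nod t : t \notin [:: u; a; b; c; d] -> ~ E u d t.
  by move=> ts; apply: no_link_edge_out _ uab ucd; distinct.
have [y [uxy _ _]] : exists y, [/\ E u x y, y != u & y != u].
  by apply: exists_third; distinct.
have uyx : E u y x by apply: edge_swapr.
have Uxy := edge_uniq uxy.
have ys : y \notin [:: a; b; c; d].
  rewrite !inE; apply/negP => /or4P[] /eqP yE; rewrite yE in uyx.
  - exact: noa xs uyx.
  - exact: nob xs uyx.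
  - exact: noc xs uyx.
  - exact: nod xs uyx.
(* Seven vertices are to be avoided, so all eight are needed. *)
have [z zs] := @exists_notin V [:: u; a; b; c; d; x; y] cardV_ge8.
have [w [azw wb wd]] : exists w, [/\ E a z w, w != b & w != d].
  by apply: exists_third; distinct.
(* [w = u] would make [az] a link edge leaving [{a, b, c, d}]. *)
have wu : w != u.
  apply/eqP => wu; apply: (noa z); first by distinct.
  by rewrite -wu; do 2 apply: edge_rot.
have wc : w = c.
  have : w \in [:: u; c; d; b].
    by apply: edge_confined _ ucd uba azw; distinct.
  by rewrite !inE (negPf wu) (negPf wb) (negPf wd) !orbF => /eqP.
have acz : E a c z.
  by rewrite -wc; apply: edge_swapr.
(* Confinement for the matching [xy, ba], with [c] as the outside vertex. *)
have : z \in [:: u; x; y; b].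
  by apply: edge_confined _ uxy uba acz; distinct.
by apply/negP; distinct.
Qed.

End LinearPath.

Theorem theorem11 (V : finType) (n : nat) (H : three_graph V)
  (cardV : #|V| = n) (n_ge8 : 8 <= n) (delta2_ge3 : 3 <= delta2 H) (u : V) :
  exists v1 v2 v3 v4 v5 v6 : V,
    [/\ uniq [:: u; v1; v2; v3; v4; v5; v6],
        [set u; v1; v2] \in edges H,
        [set u; v3; v4] \in edges H
      & [set v4; v5; v6] \in edges H].
Proof.
rewrite -cardV in n_ge8.
pose P v1 v2 v3 v4 v5 v6 :=
  [&& uniq [:: u; v1; v2; v3; v4; v5; v6], [set u; v1; v2] \in edges H,
      [set u; v3; v4] \in edges H & [set v4; v5; v6] \in edges H].
have [/existsP[v1 /existsP[v2 /existsP[v3 /existsP[v4 /existsP[v5 /existsP[v6]]]]]]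
     | nP] := boolP [exists v1, exists v2, exists v3, exists v4, exists v5,
                     exists v6, P v1 v2 v3 v4 v5 v6].
  by case/and4P=> *; exists v1, v2, v3, v4, v5, v6.
case: (no_path_false n_ge8 delta2_ge3 (u := u)) => v1 v2 v3 v4 v5 v6 Us e1 e2 e3.
case/existsP: nP; exists v1; apply/existsP; exists v2; apply/existsP; exists v3.
apply/existsP; exists v4; apply/existsP; exists v5; apply/existsP; exists v6.
exact/and4P.
Qed.
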